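(* Let $\kappa\in\mathbb{Z}_{\ge0}^n$, let $f$ be a polymatroid rank function on $[n]$, and let $J$ be its associated M-convex set. Then the rank function of the M-convex set $\mathrm{Ret}_\kappa(J)$ is $\mathrm{Ret}_\kappa(f)$; that is, for every $X\subseteq[n]$, $$\max_{x\in\mathrm{Ret}_\kappa(J)}\sum_{i\in X}x_i=\min_{Y\subseteq X}\Big(f(Y)+\sum_{i\in X\setminus Y}\kappa_i\Big).$$
   Context: Let $[n]=\{1,\dots,n\}$, let $e_i$ be the $i$-th standard basis vector, and order $\mathbb{Z}^n$ coordinatewise. A polymatroid rank function on $[n]$ is $f\colon2^{[n]}\to\mathbb{Z}_{\ge0}$ that is normalized ($f(\varnothing)=0$), monotone, and submodular. An M-convex set on $[n]$ of rank $r$ is a nonempty $J\subseteq\{\alpha\in\mathbb{Z}_{\ge0}^n:\alpha_1+\cdots+\alpha_n=r\}$ such that for all $\alpha,\beta\in J$ and $i$ with $\alpha_i<\beta_i$ there is $j$ with $\alpha_j>\beta_j$ and $\alpha+e_i-e_j,\ \beta-e_i+e_j\in J$. The rank function of an M-convex set $J$ is $f_J(A)=\max\{\sum_{i\in A}\alpha_i:\alpha\in J\}$. The map $J\mapsto f_J$ is a bijection from M-convex sets on $[n]$ to polymatroid rank functions on $[n]$, with inverse $f\mapsto J_f=\{\alpha\in\mathbb{Z}_{\ge0}^n:\sum_{i\in S}\alpha_i\le f(S)\ \forall S\subseteq[n],\ \sum_{i\in[n]}\alpha_i=f([n])\}$; the M-convex set associated to $f$ is $J_f$. $\mathrm{proj}_\kappa(v)_i=\min(v_i,\kappa_i)$,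 and $\mathrm{Ret}_\kappa(J)$ is the set of coordinatewise maximal elements of $\{\mathrm{proj}_\kappa(\alpha):\alpha\in J\}$; it is an M-convex set. For a rank function, $\mathrm{Ret}_\kappa(f)(X)=\min_{Y\subseteq X}\big(f(Y)+\kappa(X\setminus Y)\big)$, where $\kappa(S)=\sum_{i\in S}\kappa_i$; it is a polymatroid rank function. *)

(* Defs.v *)
From mathcomp Require Export all_boot.
From mathcomp Require Export classical_sets.

Set Implicit Arguments.
Unset Strict Implicit.
Unset Printing Implicit Defensive.

(* Z_{>=0}^n, with coordinates indexed by {0, ..., n-1} instead of {1, ..., n}. *)
Definition point (n : nat) := {ffun 'I_n -> nat}.

Definition coord_sum (n : nat) (a : point n) (A : {set 'I_n}) : nat :=
  \sum_(i in A) a i.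

Definition point_le (n : nat) (a b : point n) : Prop := forall i, a i <= b i.

Definition polymatroid (n : nat) (f : {set 'I_n} -> nat) : Prop :=
  [/\ f finset.set0 = 0,
      forall A B : {set 'I_n}, A \subset B -> f A <= f B
    & forall A B : {set 'I_n}, f (A :|: B) + f (A :&: B) <= f A + f B].

(* a + e_i - e_j; the truncated subtraction is exact when 0 < a j. *)
Definition exchange (n : nat) (a : point n) (i j : 'I_n) : point n :=
  [ffun k => a k + (k == i) - (k == j)].

(* In the exchange axiom a j > b j and b i > a i, so the two coordinates that
   are decreased are positive. *)
Definition M_convex_of_rank (n r : nat) (J : set (point n)) : Prop :=
  [/\ exists a, J a,
      forall a, J a -> coord_sum a [set: 'I_n] = r
    & forall a b, J a -> J b -> forall i, a i < b i ->
        exists j, [/\ b j < a j, J (exchange a i j) & J (exchange b j i)]].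

Definition M_convex (n : nat) (J : set (point n)) : Prop :=
  exists r, M_convex_of_rank r J.

Definition is_max (V : set nat) (m : nat) : Prop :=
  V m /\ forall v, V v -> v <= m.

(* g = f_J, i.e. g A = max {sum_(i in A) a_i : a in J} for every A. *)
Definition is_rank_function (n : nat) (J : set (point n))
    (g : {set 'I_n} -> nat) : Prop :=
  forall A : {set 'I_n}, is_max (fun v => exists2 a, J a & coord_sum a A = v) (g A).

(* J_f *)
Definition associated (n : nat) (f : {set 'I_n} -> nat) : set (point n) :=
  fun a => (forall S : {set 'I_n}, coord_sum a S <= f S) /\
           coord_sum a [set: 'I_n] = f [set: 'I_n].

Definition proj (n : nat) (kappa a : point n) : point n :=
  [ffun i => minn (a i) (kappa i)].

Definition maximal_points (n : nat) (V : set (point n)) : set (point n) :=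
  fun a => V a /\ forall b, V b -> point_le a b -> b = a.

Definition Ret_set (n : nat) (kappa : point n) (J : set (point n)) :
    set (point n) :=
  maximal_points (fun b => exists2 a, J a & proj kappa a = b).

(* The default value f X is the term for Y = X, so this is the minimum over
   all subsets Y of X. *)
Definition Ret_rank (n : nat) (kappa : point n) (f : {set 'I_n} -> nat)
    (X : {set 'I_n}) : nat :=
  \big[minn/f X]_(Y : {set 'I_n} | Y \subset X) (f Y + coord_sum kappa (X :\: Y)).

(* Main.v *)
Require Import Defs.
From mathcomp Require Import finset zify.

Set Implicit Arguments.
Unset Strict Implicit.
Unset Printing Implicit Defensive.

(** For a polymatroid rank function [f], call a vector [a] independent when
    [a(S) <= f(S)] for every [S], and call [S] tight when equality holds.
    Submodularity makes the tight sets of an independent vector a lattice, and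
    three consequences of this carry the proof.

    - An independent vector lies below a point of [associated f]: a coordinate
      outside every tight set can be raised, and if there is no such coordinate
      then the whole ground set, being a union of tight sets, is tight
      ([independent_extension]).
    - Hence [f] is the rank function of [associated f]: a set [A] is
      saturated by extending [0] inside the restriction of [f] to [A]
      ([associated_rank]).
    - [associated f] is M-convex: an index that can be exchanged simultaneously
      in [a] and [b] is found between the least [a]-tight set containing [i] and
      the greatest [b]-tight set avoiding [i] ([associated_M_convex]).

    It remains to see that [Ret_set kappa (associated f)] is [associated g] for
    [g = Ret_rank kappa f], which is again a polymatroid.  The point is that the
    [g]-independent vectors are exactly the [f]-independent vectors bounded by
    [kappa].  Every truncation of a point of [associated f] is such a vector,
    and every such vector lies below such a truncation by extension, so both
    sets have the same maximal elements; by extension for [g], those are the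
    points of [associated g]. *)

(** * Coordinate sums *)

Section CoordinateSums.
Variable n : nat.
Implicit Types (a b : point n) (A B S : {set 'I_n}) (i j : 'I_n).

Lemma coord_sum0 a : coord_sum a set0 = 0.
Proof. by rewrite /coord_sum big_set0. Qed.

Lemma coord_sum1 a i : coord_sum a [set i] = a i.
Proof. by rewrite /coord_sum big_set1. Qed.

Lemma coord_sumID a A B :
  coord_sum a A = coord_sum a (A :&: B) + coord_sum a (A :\: B).
Proof. by rewrite /coord_sum (big_setID B). Qed.

Lemma coord_sumUI a A B :
  coord_sum a (A :|: B) + coord_sum a (A :&: B) = coord_sum a A + coord_sum a B.
Proof.
rewrite (coord_sumID a (A :|: B) B) (coord_sumID a A B)
  [(A :|: B) :&: B]setIC setKU setDUl setDv setU0.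
lia.
Qed.

Lemma coord_sumS a A B : A \subset B -> coord_sum a A <= coord_sum a B.
Proof. by move=> /setIidPr AB; rewrite (coord_sumID a B A) AB leq_addr. Qed.

Lemma coord_sum_leq a b S :
  (forall i, i \in S -> a i <= b i) -> coord_sum a S <= coord_sum b S.
Proof. by move=> leab; apply: leq_sum. Qed.

Lemma coord_sum_ltn a b S i :
    i \in S -> (forall j, j \in S -> a j <= b j) -> a i < b i ->
  coord_sum a S < coord_sum b S.
Proof.
move=> iS leab ltab; rewrite /coord_sum !(bigD1 i iS) /= -addSn leq_add //.
by apply: leq_sum => j /andP[jS _]; apply: leab.
Qed.

Lemma point_le_eq a b :
  point_le a b -> coord_sum b [set: 'I_n] <= coord_sum a [set: 'I_n] -> b = a.
Proof.
move=> leab leba; apply/ffunP => i; apply/eqP; rewrite eqn_leq leab andbT.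
rewrite leqNgt; apply/negP => ltab.
by have := @coord_sum_ltn a b [set: 'I_n] i (in_setT i) (fun j _ => leab j) ltab;
  rewrite ltnNge leba.
Qed.

Lemma sum_indicator S j : \sum_(i in S) (i == j : nat) = (j \in S).
Proof.
case: (boolP (j \in S)) => jS.
  by rewrite (bigD1 j jS) eqxx big1 //= => i /andP[_ /negPf->].
by rewrite big1 // => i iS; case: eqP iS jS => // -> ->.
Qed.

Definition raise a i : point n := [ffun k => a k + (k == i)].

Lemma coord_sum_raise a i S :
  coord_sum (raise a i) S = coord_sum a S + (i \in S).
Proof.
rewrite /coord_sum -sum_indicator -big_split.
by apply: eq_bigr => k _; rewrite ffunE.
Qed.

(** Stated additively, since the sum over [S] drops by one when [j] but not
    [i] belongs to [S]. *)
Lemma coord_sum_exchange a i j S : 0 < a j ->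
  coord_sum (exchange a i j) S + (j \in S) = coord_sum a S + (i \in S).
Proof.
move=> aj; rewrite /coord_sum -!sum_indicator -!big_split.
apply: eq_bigr => k _; rewrite ffunE /=.
case: (k =P j) => [->|_]; last by rewrite subn0 addn0.
by case: (j == i); lia.
Qed.

End CoordinateSums.

(** * Tight sets *)

Definition independent n (f : {set 'I_n} -> nat) (a : point n) : Prop :=
  forall S : {set 'I_n}, coord_sum a S <= f S.

Definition tight n (f : {set 'I_n} -> nat) (a : point n) (S : {set 'I_n}) : bool :=
  coord_sum a S == f S.

Section Polymatroid.
Variables (n : nat) (f : {set 'I_n} -> nat).
Hypothesis f_polymatroid : polymatroid f.
Implicit Types (a b : point n) (S T : {set 'I_n}) (i j : 'I_n).

(** The sum of [a] over [S :|: T] and [S :&: T] equals [f S + f T], which is at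
    least the sum of the two bounds, so neither bound can be slack. *)
Lemma tightUI a S T : independent f a -> tight f a S -> tight f a T ->
  tight f a (S :|: T) && tight f a (S :&: T).
Proof.
case: f_polymatroid => _ _ f_submod inda /eqP aS /eqP aT; rewrite /tight.
have := coord_sumUI a S T; have := f_submod S T.
have := inda (S :|: T); have := inda (S :&: T); lia.
Qed.

Lemma tight_bigcup a (P : pred {set 'I_n}) : independent f a ->
  tight f a (\bigcup_(S | tight f a S && P S) S).
Proof.
move=> inda; apply: (big_ind (tight f a)) => [|S T tS tT|S /andP[] //].
  by case: f_polymatroid => f0 _ _; rewrite /tight coord_sum0 f0.
by case/andP: (tightUI inda tS tT).
Qed.

Lemma tight_bigcap a (P : pred {set 'I_n}) : associated f a ->
  tight f a (\bigcap_(S | tight f a S && P S) S).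
Proof.
case=> inda aT; apply: (big_ind (tight f a)) => [|S T tS tT|S /andP[] //].
  exact/eqP.
by case/andP: (tightUI inda tS tT).
Qed.

Lemma independent_raise a : independent f a ->
    coord_sum a [set: 'I_n] < f [set: 'I_n] ->
  exists i, independent f (raise a i).
Proof.
move=> inda lta; set U := \bigcup_(S | tight f a S && predT S) S.
have tU : tight f a U by apply: tight_bigcup.
have [i iU] : exists i, i \notin U.
  apply/existsP; rewrite -negb_forall; apply/negP => /forallP allU.
  have UT : U = [set: 'I_n] by apply/setP=> i; rewrite allU inE.
  by move: tU; rewrite /tight UT; lia.
exists i => S; rewrite coord_sum_raise; have := inda S.
case: (boolP (i \in S)) => iS; last by rewrite addn0.
rewrite addn1 ltn_neqAle => ->; rewrite andbT.
apply: contra iU => tS; apply/bigcupP; exists S => //.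
by rewrite andbT.
Qed.

Lemma independent_extension a : independent f a ->
  exists2 b, associated f b & point_le a b.
Proof.
have [m] := ubnP (f [set: 'I_n] - coord_sum a [set: 'I_n]).
elim: m a => // m IHm a gap inda.
have := inda [set: 'I_n]; rewrite leq_eqVlt => /predU1P[aT|lta].
  by exists a => // i.
have [i indai] := independent_raise inda lta.
have [|b fb leb] := IHm _ _ indai.
  by rewrite coord_sum_raise in_setT; lia.
by exists b => // k; apply: leq_trans (leb k); rewrite ffunE leq_addr.
Qed.

Lemma independentW a b : point_le a b -> independent f b -> independent f a.
Proof.
by move=> leab indb S; apply: leq_trans (indb S); apply: coord_sum_leq.
Qed.

(** * M-convexity *)

(** The coordinate sum grows, by one, exactly over the sets that contain [i] but
    not [j]; the hypothesis says that these are not tight. *)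
Lemma associated_exchange a i j : associated f a -> 0 < a j ->
    (forall S, tight f a S -> i \in S -> j \in S) ->
  associated f (exchange a i j).
Proof.
case=> inda aT aj tightP; split=> [S|]; last first.
  by have := coord_sum_exchange i [set: 'I_n] aj; rewrite !in_setT; lia.
have := coord_sum_exchange i S aj; have := inda S; have := tightP S.
by rewrite /tight; case: (i \in S); case: (j \in S); lia.
Qed.

(** With [T] the least [a]-tight set containing [i] and [U] the greatest
    [b]-tight set avoiding [i], every [j] in [T :\: U] with [b j < a j]
    gives points [a + e_i - e_j] and [b - e_i + e_j] of [associated f].  If
    there were no such [j], then [a] would be smaller than [b] on [T :\: U], strictly so at
    [i], and submodularity at [T] and [U] would fail. *)
Lemma associated_M_convex : M_convex (associated f).
Proof.
case: (f_polymatroid) => f0 _ f_submod; exists (f [set: 'I_n]); split.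
- have ind0 : independent f [ffun=> 0].
    by move=> S; rewrite /coord_sum big1 // => i _; rewrite ffunE.
  by have [a fa _] := independent_extension ind0; exists a.
- by move=> a [].
move=> a b fa fb i ltab; have [inda _] := fa; have [indb _] := fb.
set T := \bigcap_(S | tight f a S && (i \in S)) S.
set U := \bigcup_(S | tight f b S && (i \notin S)) S.
have tT : tight f a T by apply: tight_bigcap.
have tU : tight f b U by apply: tight_bigcup.
have iT : i \in T by apply/bigcapP => S /andP[].
have iU : i \notin U by apply/bigcupP => -[S /andP[_ /negPf->]].
have [j /andP[jTU ltba]] : exists j, (j \in T :\: U) && (b j < a j).
  apply/existsP; apply: contraT; rewrite negb_exists => /forallP noj.
  have lesum : coord_sum a (T :\: U) < coord_sum b (T :\: U).
    apply: (@coord_sum_ltn _ _ _ _ i) => //; first by rewrite in_setD iU.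
    by move=> j jTU; have := noj j; rewrite jTU -leqNgt.
  have := coord_sumID a T U; have := coord_sumID b T U.
  have := coord_sumUI b T U; have := f_submod T U.
  have := inda (T :&: U); have := indb (T :|: U).
  by move: tT tU; rewrite /tight; lia.
have [jT jU] : j \in T /\ j \notin U by move: jTU; rewrite in_setD => /andP[].
exists j; split=> //; apply: associated_exchange => //.
- by apply: leq_ltn_trans ltba.
- by move=> S tS iS; apply: (bigcapP jT); rewrite tS iS.
- by apply: leq_ltn_trans ltab.
move=> S tS jS; apply: contraNT jU => iS.
by apply/bigcupP; exists S; rewrite ?tS ?iS.
Qed.

End Polymatroid.

(** * The rank function of the associated set *)

(** Extending [0] for the restriction [S |-> f (S :&: A)] yields a vector of
    total [f A]; it vanishes off [A], hence sums to [f A] over [A]. *)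
Lemma associated_rank n (f : {set 'I_n} -> nat) :
  polymatroid f -> is_rank_function (associated f) f.
Proof.
move=> fP A; case: (fP) => f0 f_mono f_submod; split; last first.
  by move=> _ [a [inda _] <-].
have fAP : polymatroid (fun S => f (S :&: A)).
  split=> [|S T ST|S T]; first by rewrite set0I.
    by rewrite f_mono // setSI.
  by have := f_submod (S :&: A) (T :&: A); rewrite -setIUl setIACA setIid.
have ind0 : independent (fun S => f (S :&: A)) [ffun=> 0].
  by move=> S; rewrite /coord_sum big1 // => i _; rewrite ffunE.
have [a [indA]] := independent_extension fAP ind0; rewrite setTI => aT _.
have inda : independent f a.
  by move=> S; apply: leq_trans (indA S) _; rewrite f_mono // subsetIl.
have aA : coord_sum a A = f A.
  have := coord_sumID a [set: 'I_n] A; have := indA ([set: 'I_n] :\: A).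
  by rewrite setTI setTD [_ :&: A]setIC setICr f0; lia.
have [b fb leab] := independent_extension fP inda; exists b => //.
have [indb _] := fb; apply/eqP; rewrite eqn_leq indb -aA.
by apply: coord_sum_leq => i _; apply: leab.
Qed.

(** * Truncating the rank function *)

Section Truncation.
Variables (n : nat) (kappa : point n) (f : {set 'I_n} -> nat).
Hypothesis f_polymatroid : polymatroid f.
Implicit Types (a b : point n) (X Y : {set 'I_n}).

Lemma Ret_rank_le X Y : Y \subset X ->
  Ret_rank kappa f X <= f Y + coord_sum kappa (X :\: Y).
Proof.
move=> YX; rewrite /Ret_rank; have: Y \in index_enum {set 'I_n}.
  exact: mem_index_enum.
elim: (index_enum _) => // Z s IHs; rewrite in_cons big_cons.
case/predU1P => [<-|/IHs leY]; first by rewrite YX geq_minl.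
by case: ifP => // _; apply: leq_trans (geq_minr _ _) leY.
Qed.

Lemma Ret_rank_attained X : exists2 Y : {set 'I_n}, Y \subset X &
  Ret_rank kappa f X = f Y + coord_sum kappa (X :\: Y).
Proof.
pose attained v := exists2 Y : {set 'I_n}, Y \subset X &
  v = f Y + coord_sum kappa (X :\: Y).
apply: (big_ind attained) => [|u v [Y YX uE] [Z ZX vE]|Y YX].
- by exists X => //; rewrite setDv coord_sum0 addn0.
- by case: (leqP u v) => _; [exists Y|exists Z].
by exists Y.
Qed.

Lemma Ret_rank_polymatroid : polymatroid (Ret_rank kappa f).
Proof.
case: f_polymatroid => f0 f_mono f_submod; split=> [|A B AB|A B].
- apply/eqP; rewrite -leqn0; apply: leq_trans (Ret_rank_le (subxx _)) _.
  by rewrite setDv coord_sum0 f0.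
- have [Y YB ->] := Ret_rank_attained B.
  apply: leq_trans (Ret_rank_le (subsetIl A Y)) _.
  rewrite leq_add ?f_mono ?subsetIr // coord_sumS //.
  by rewrite setDIr setDv set0U setSD.
have [Y YA ->] := Ret_rank_attained A; have [Z ZB ->] := Ret_rank_attained B.
have leU := Ret_rank_le (setUSS YA ZB); have leI := Ret_rank_le (setISS YA ZB).
(* Because Y and Z are contained in A and B, the kappa-terms are differences of
   sums, so their total is the same for the union-intersection pair. *)
have kD (C D : {set 'I_n}) : D \subset C ->
    coord_sum kappa C = coord_sum kappa D + coord_sum kappa (C :\: D).
  by move=> /setIidPr DC; rewrite (coord_sumID kappa C D) DC.
have := kD _ _ YA; have := kD _ _ ZB.
have := kD _ _ (setUSS YA ZB); have := kD _ _ (setISS YA ZB).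
have := coord_sumUI kappa A B; have := coord_sumUI kappa Y Z.
have := f_submod Y Z; lia.
Qed.

(** In the minimum defining [Ret_rank], [Y = X] gives the constraints of [f] and
    [Y = set0], for [X] a singleton, those of [kappa]; conversely these bound [a] on [Y] by [f] and
    on [X :\: Y] by [kappa]. *)
Lemma independent_Ret_rank a :
  independent (Ret_rank kappa f) a <-> independent f a /\ point_le a kappa.
Proof.
case: f_polymatroid => f0 _ _; split=> [inda|[inda leak] X].
  split=> [S|i].
    apply: leq_trans (inda S) _; apply: leq_trans (Ret_rank_le (subxx S)) _.
    by rewrite setDv coord_sum0 addn0.
  rewrite -(coord_sum1 a) -(coord_sum1 kappa); apply: leq_trans (inda _) _.
  by apply: leq_trans (Ret_rank_le (sub0set _)) _; rewrite f0 setD0.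
have [Y /setIidPr YX ->] := Ret_rank_attained X.
rewrite (coord_sumID a X Y) YX leq_add //.
by apply: coord_sum_leq => i _; apply: leak.
Qed.

Lemma proj_independent a :
  associated f a -> independent (Ret_rank kappa f) (proj kappa a).
Proof.
case=> inda _; apply/independent_Ret_rank; split.
  by apply: independentW inda => i; rewrite ffunE geq_minl.
by move=> i; rewrite ffunE geq_minr.
Qed.

Lemma independent_below_proj b : independent (Ret_rank kappa f) b ->
  exists2 a, associated f a & point_le b (proj kappa a).
Proof.
move=> /independent_Ret_rank[indb lebk].
have [a fa leba] := independent_extension f_polymatroid indb.
by exists a => // i; rewrite ffunE leq_min leba lebk.
Qed.

Lemma Ret_set_associated :
  Ret_set kappa (associated f) = associated (Ret_rank kappa f).
Proof.
apply/seteqP; split=> b.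
  case=> -[a fa <-] maxb; have indb := proj_independent fa.
  have [c gc lebc] := independent_extension Ret_rank_polymatroid indb.
  have [indc _] := gc; have [d fd lecd] := independent_below_proj indc.
  (* Maximality collapses the chain  proj a <= c <= proj d. *)
  have dE : proj kappa d = proj kappa a.
    by apply: maxb => [|i]; [exists d|apply: leq_trans (lebc i) (lecd i)].
  suff <- : c = proj kappa a by [].
  by apply/ffunP => i; apply/eqP; rewrite eqn_leq lebc -dE lecd.
case=> indb bT.
have maxb c : independent (Ret_rank kappa f) c -> point_le b c -> c = b.
  by move=> indc lebc; apply: point_le_eq => //; rewrite bT.
split=> [|_ [a fa <-] leba]; last by apply: maxb leba; apply: proj_independent.
have [a fa leba] := independent_below_proj indb.
by exists a => //; apply: maxb leba; apply: proj_independent.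
Qed.

End Truncation.

Theorem corollary4p10 (n : nat) (kappa : point n) (f : {set 'I_n} -> nat)
    (f_polymatroid : polymatroid f) :
  M_convex (Ret_set kappa (associated f)) /\
  is_rank_function (Ret_set kappa (associated f)) (Ret_rank kappa f).
Proof.
have gP := Ret_rank_polymatroid kappa f_polymatroid.
rewrite Ret_set_associated //; split; first exact: associated_M_convex.
exact: associated_rank.
Qed.
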